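(* Let $0<d<b$ and $k\ge1$ be integers, with $b\ge2$. Then \begin{align*} I(b,d,k)={}&b\log(b)+\sum_{m=1}^\infty(-1)^{m-1}(u_{k;m}-u_{k-1;m})\Bigl(\sum_{n=1}^\infty\frac1{(bn+d)^{m+1}}+\sum_{0\le a<b,\ a\ne d}\frac1{(bd+a)^{m+1}}\Bigr)\\ &+\delta_{k>1}\sum_{m=1}^\infty(-1)^{m-1}\frac{u_{k-1;m}-u_{k-2;m}}{(bd+d)^{m+1}}\\ &+\delta_{k=1}\Bigl(\frac1{bd+d}+\sum_{m=1}^\infty(-1)^{m-1}\frac{u_{0;m}}{(bd+d)^{m+1}}\Bigr), \end{align*} where $\delta_{P}$ equals $1$ if the condition $P$ holds and $0$ otherwise.
   Context: For integers $b\ge 2$, $0\le d<b$ and $k\ge 0$, $I(b,d,k)=\sum \frac1m$, where the sum runs over all integers $m>0$ whose base-$b$ representation (without leading zeros) contains exactly $k$ occurrences of the digit $d$ (this series converges). Let $\mathsf D=\{0,\dots,b-1\}$. For a string $X=(d_l,\dots,d_1)\in\mathsf D^l$ of length $|X|=l\ge0$ put $n(X)=d_lb^{l-1}+\dots+d_1b^0$ and $x(X)=n(X)/b^{l}\in[0,1)$ (with $x(X)=0$ for the empty string). The measure $\mu_k$ (depending also on $b$ and $d$) on $[0,1)$ is $\mu_k=\sum_X b^{-|X|}\delta_{x(X)}$ (here $\delta_{x(X)}$ is the Dirac mass), the sum being over all strings $X$ (of all lengths $l\ge 0$) that contain exactly $k$ occurrences of the digit $d$; leading zeros count as digits of the string.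 It is a finite measure of total mass $b$. Its moments are $u_{k;m}=\int_{[0,1)}x^m\,\mu_k(dx)$, $m\ge0$. *)

(* Defs.v *)
From HB Require Import structures.
From mathcomp Require Import all_boot all_order all_algebra.
From mathcomp Require Import all_classical all_reals all_analysis.

Set Implicit Arguments.
Unset Strict Implicit.
Unset Printing Implicit Defensive.

Import Order.TTheory GRing.Theory Num.Theory.
Import numFieldNormedType.Exports.

Local Open Scope classical_set_scope.
Local Open Scope ring_scope.

(* The digits of m in base b, units first and without leading zeros, for
   b > 1 and m > 0: [trunc_log b m] is then the largest e with b ^ e <= m. *)
Definition digits (b m : nat) : seq nat :=
  [seq ((m %/ b ^ i) %% b)%N | i <- iota 0 (trunc_log b m).+1].

(* An extended real, so that the convergence of the series is not presupposed. *)
Definition irwin_sum (R : realType) (b d k : nat) : \bar R :=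
  (\sum_(1 <= m <oo | count_mem d (digits b m) == k) (m%:R^-1)%:E)%E.

(* A string (d_l, ..., d_1) is the sequence [:: d_l; ...; d_1]. *)
Notation string b := (seq 'I_b).

Definition occ (b d : nat) (X : string b) : nat := count_mem d (map val X).

Definition str_nat (b : nat) (X : string b) : nat :=
  (\sum_(i < size X) nth 0%N (rev (map val X)) i * b ^ i)%N.

Definition str_real (R : realType) (b : nat) (X : string b) : R :=
  (str_nat X)%:R / b%:R ^+ size X.

Section irwin_measure.
Context (R : realType) (b d k : nat).
Local Open Scope ereal_scope.

(* The measure is defined on the Borel sets of R; it is carried by [0, 1). *)
Definition irwin_measure (A : set (measurableTypeR R)) : \bar R :=
  \esum_(X in [set X : string b | occ d X = k])
    ((b%:R ^- size X)%:E * \d_(str_real R X : measurableTypeR R) A).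

Let term_ge0 (X : string b) (A : set (measurableTypeR R)) :
  0 <= (b%:R ^- size X)%:E * \d_(str_real R X : measurableTypeR R) A :> \bar R.
Proof. by rewrite mule_ge0// lee_fin invr_ge0 exprn_ge0. Qed.

Let irwin_measure0 : irwin_measure set0 = 0.
Proof. by rewrite /irwin_measure esum1// => X _; rewrite measure0 mule0. Qed.

Let irwin_measure_ge0 A : 0 <= irwin_measure A.
Proof. exact: esum_ge0. Qed.

Let irwin_measure_semi_sigma_additive : semi_sigma_additive irwin_measure.
Proof.
move=> F mF tF mUF.
rewrite [X in _ --> X](_ : _ = \sum_(0 <= n <oo) irwin_measure (F n)).
  by apply: is_cvg_nneseries => n _ _; exact: irwin_measure_ge0.
rewrite nneseries_esumT; last by move=> n; exact: irwin_measure_ge0.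
rewrite /irwin_measure esum_esum//.
set S := [set X | _].
rewrite (reindex_esum (S `*`` fun=> [set: nat]) _ (fun p => (p.2, p.1))); last first.
  split=> [[X n] []//|[X n] [Y m] _ _ [-> ->]//|[n X] [_ SX]].
  by exists (X, n).
rewrite -(esum_esum (I := S) (J := fun=> [set: nat]) (a := fun X n =>
  (b%:R ^- size X)%:E * \d_(str_real R X : measurableTypeR R) (F n)))//.
apply: eq_esum => X _.
rewrite -nneseries_esumT; last by move=> n; exact: term_ge0.
rewrite nneseriesZl//; first by rewrite measure_semi_bigcup.
Qed.

HB.instance Definition _ := isMeasure.Build _ _ _ irwin_measure
  irwin_measure0 irwin_measure_ge0 irwin_measure_semi_sigma_additive.

End irwin_measure.
Arguments irwin_measure : clear implicits.

Definition moment (R : realType) (b d k m : nat) : R :=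
  \int[irwin_measure R b d k]_(x in `[0%R, 1%R[) (x ^+ m).

Notation "\sum_ ( m <= i '<oo' ) F" :=
  (\big[+%R/0%R]_(m <= i <oo) F%R) : ring_scope.

(* Main.v *)
Require Import Defs.
From mathcomp Require Import all_boot all_order all_algebra.
From mathcomp Require Import all_classical all_reals all_analysis.
From mathcomp Require Import measurable_realfun.
From mathcomp Require Import ring lra zify.

(** Write [U_k(n)] for the integral of [1 / (n + x)] against [mu_k]; it is the
    sum of [1 / m] over the integers [m] whose digits are those of [n] followed
    by a string with [k] occurrences of [d] ([tail] below). Grouping integers
    by their first digit gives ([irwin_sum_tail])

      [I(b, d, k) = sum_(0 < a < b) U_k(a) - U_k(d) + U_(k-1)(d)],

    and grouping the extensions of [n] by their next digit gives ([tail_rec])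

      [U_k(n) = sum_(a != d) U_k(b * n + a) + U_(k-1)(b * n + d)]

    for [k >= 1], with an additional [1 / n] for [k = 0].

    The logarithm comes from [S_J], the sum of [U_k(n)] over the [n] with
    [b ^ J <= n < b ^ (J + 1)]. Since [mu_k] has mass [b], [U_k(n)] is close to
    [b / n], and [S_J] tends to [b * ln b] ([cvg_block]). By the recurrence,
    [S_J - S_(J+1)] is the sum of [U_(k-1)(b * n + d) - U_k(b * n + d)] over the
    same [n]. Hence ([sum_tail_first_digit])

      [S_0 = b * ln b + sum_(n >= 1) (U_(k-1)(b * n + d) - U_k(b * n + d))],

    where [S_0] is the sum of the [U_k(a)] over the nonzero digits [a]. What
    remains of [I(b, d, k)] is [U_(k-1)(d) - U_k(d)]; the recurrence, applied to
    both terms, turns it into the differences at [b * d + a], and the empty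
    string is what distinguishes [k = 1] from [k > 1].

    Finally every difference [U_(k-1)(n) - U_k(n)] that occurs has [n >= 2] and
    is expanded in powers of [1 / n] by the geometric series; the coefficients
    are differences of moments, and the term of order [1 / n] vanishes because
    the masses agree ([tail_diff_expansion]). The remainder after [M] terms is
    at most [b / n ^ (M + 1)], which suffices to sum over [n] first
    ([cvg_sum_expansion]). *)

Set Implicit Arguments.
Unset Strict Implicit.
Unset Printing Implicit Defensive.

Import Order.TTheory GRing.Theory Num.Theory.
Import numFieldNormedType.Exports.

Local Open Scope classical_set_scope.
Local Open Scope ring_scope.

(** * Sums over countable types *)

(** Enumerating a countable type along the naturals, with the value 0 at the
    codes of nothing, makes results on series over the naturals (exchange with
    the integral, scaling) available for sums over strings. *)
Lemma esum_pickle (R : realType) (T : countType) (A : set T)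
    (a : T -> \bar R) : (forall x, 0 <= a x)%E ->
  \esum_(x in A) a x =
  (\sum_(n <oo) oapp (fun x => if x \in A then a x else 0%E) 0%E
                    (pickle_inv n))%E.
Proof.
move=> a0.
pose g n := oapp (fun x => if x \in A then a x else 0%E) 0%E
  (@pickle_inv T n).
have g0 n : (0 <= g n)%E.
  by rewrite /g; case: pickle_inv => //= x; case: ifP.
rewrite -/g nneseries_esumT// esum_mkcond.
have -> : \esum_(x in [set: T]) (if x \in A then a x else 0)%E
    = \esum_(x in [set: T]) g (pickle x).
  by apply: eq_esum => x _; rewrite /g pickleK_inv.
rewrite -(@esum_image _ _ _ setT (@pickle T) g); last first.
  by move=> x y _ _; exact: (pcan_inj pickleK_inv).
rewrite esum_mkcond; apply: eq_esum => n _.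
case: ifPn => //; rewrite notin_setE => /= nT; rewrite /g.
case E: (pickle_inv n) => [x|//]; case: nT; exists x => //.
by have := @pickle_invK T n; rewrite E.
Qed.

Lemma esumZ (R : realType) (T : countType) (A : set T) (c : R)
    (a : T -> \bar R) : (forall x, 0 <= a x)%E -> 0 <= c ->
  \esum_(x in A) (c%:E * a x)%E = (c%:E * \esum_(x in A) a x)%E.
Proof.
move=> a0 c0; rewrite !esum_pickle//; last by move=> x; rewrite mule_ge0.
rewrite -nneseriesZl; last first.
  by move=> n _; case: pickle_inv => //= x; case: ifP.
apply: eq_eseriesr => n _; case: pickle_inv => [x|] /=; last by rewrite mule0.
by case: ifP; rewrite ?mule0.
Qed.

(** * Strings of digits and integration against their measure *)

(** For [Q = predT] this is the integral of [f] against [mu_k]. The predicate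
    [Q] on lengths allows arguing by induction on a bound for the lengths,
    which is how finiteness is obtained: the recursion on the first digit alone
    is consistent with the value [+oo]. *)
Definition strsum (R : realType) (b d : nat) (Q : pred nat) (k : nat)
    (f : R -> R) : \bar R :=
  \esum_(X in [set X : string b | occ d X = k /\ Q (size X)])
    (b%:R ^- size X * f (str_real R X))%:E.

Lemma str_nat_cons b (a : 'I_b) (X : string b) :
  str_nat (a :: X) = (a * b ^ size X + str_nat X)%N.
Proof.
rewrite /str_nat /= rev_cons big_ord_recr/= addnC nth_rcons size_rev size_map.
rewrite ltnn eqxx; congr addn; apply: eq_bigr => i _.
by rewrite nth_rcons size_rev size_map ltn_ord.
Qed.

Lemma str_nat_rcons b (X : string b) (a : 'I_b) :
  str_nat (rcons X a) = (b * str_nat X + a)%N.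
Proof.
rewrite /str_nat map_rcons rev_rcons size_rcons big_ord_recl/= expn0 muln1.
rewrite addnC big_distrr/=; congr addn; apply: eq_bigr => i _.
by rewrite expnS mulnCA.
Qed.

Lemma str_nat_lt b (X : string b) : (str_nat X < b ^ size X)%N.
Proof.
elim: X => [|a X IH]; first by rewrite /str_nat big_ord0.
rewrite str_nat_cons /= expnS.
rewrite (leq_trans (n := a.+1 * b ^ size X)%N) ?leq_mul2r ?ltn_ord ?orbT//.
by rewrite mulSn addnC ltn_add2r.
Qed.

Lemma str_real_ge0 (R : realType) b (X : string b) : 0 <= str_real R X.
Proof. by rewrite /str_real divr_ge0// exprn_ge0. Qed.

Lemma str_real_lt1 (R : realType) b (X : string b) : str_real R X < 1.
Proof.
have := str_nat_lt X => h.
rewrite /str_real ltr_pdivrMr ?mul1r -natrX ?ltr_nat// ltr0n.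
exact: leq_ltn_trans h.
Qed.

Lemma str_real_nil (R : realType) b : str_real R ([::] : string b) = 0.
Proof. by rewrite /str_real /str_nat big_ord0 mul0r. Qed.

Lemma str_real_cons (R : realType) b (a : 'I_b) (X : string b) :
  str_real R (a :: X) = (a%:R + str_real R X) / b%:R.
Proof.
have b0 : (b%:R : R) != 0.
  by rewrite pnatr_eq0 -lt0n (leq_ltn_trans _ (ltn_ord a)).
rewrite /str_real str_nat_cons /= natrD natrM natrX exprS.
by have := expf_neq0 (size X) b0 => h; field; rewrite b0 h.
Qed.

(** Along an enumeration of the strings, [mu_k] is a series of scaled Dirac
    masses, and a nonnegative function may be integrated term by term. *)
Lemma integral_irwin_measure (R : realType) (b d k : nat) (f : R -> R) :
  measurable_fun (`[0%R, 1%R[%classic : set (measurableTypeR R)) f ->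
  (forall x, 0 <= x < 1 -> 0 <= f x) ->
  (\int[irwin_measure R b d k]_(x in `[0%R, 1%R[) (f x)%:E)%E
    = strsum b d predT k f.
Proof.
move=> mf f0.
have c0 (X : string b) : 0 <= (b%:R ^- size X : R).
  by rewrite invr_ge0 exprn_ge0.
pose A := [set X : string b | occ d X = k].
pose dm X : {measure set (measurableTypeR R) -> \bar R} :=
  mscale (NngNum (c0 X)) (dirac (str_real R X : measurableTypeR R)).
pose m n : {measure set (measurableTypeR R) -> \bar R} :=
  if @pickle_inv (string b) n is Some X then
    if X \in A then dm X else mzero else mzero.
have mE n (B : set (measurableTypeR R)) : m n B =
    oapp (fun X => if X \in A then ((b%:R ^- size X)%:E *
        (\d_(str_real R X : measurableTypeR R) B))%E else 0%E)
      0%E (@pickle_inv (string b) n).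
  by rewrite /m; case: pickle_inv => //= X; case: ifP.
have mf' := iffRL (measurable_EFinP _ _) mf.
rewrite (@eq_measure_integral _ _ _ _ (mseries m 0)); last first.
  move=> B _ _; rewrite /= /irwin_measure /mseries esum_pickle; last first.
    by move=> X; rewrite mule_ge0// lee_fin.
  by apply: eq_eseriesr => n _; rewrite mE.
rewrite ge0_integral_measure_series//.
have -> : strsum b d predT k f =
    \esum_(X in A) (b%:R ^- size X * f (str_real R X))%:E.
  by rewrite /strsum; congr esum; apply/seteqP; split => X //= [].
rewrite esum_mkcond esum_pickle; last first.
  move=> X; case: ifP => // _; rewrite lee_fin mulr_ge0//.
  by rewrite f0 ?str_real_ge0 ?str_real_lt1.
apply: eq_eseriesr => n _; rewrite /m.
case: pickle_inv => [X|] /=; last by rewrite integral_measure_zero.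
rewrite in_setT /A; case: ifP => _; last by rewrite integral_measure_zero.
rewrite ge0_integral_mscale//.
rewrite integral_dirac//= diracE mem_set ?mul1e//=.
by rewrite in_itv/= str_real_ge0 str_real_lt1.
Qed.

Lemma momentE (R : realType) (b d k m : nat) :
  moment R b d k m = fine (strsum b d predT k (fun x : R => x ^+ m)).
Proof.
rewrite /moment /Rintegral integral_irwin_measure//.
by move=> x /andP[x0 _]; rewrite exprn_ge0.
Qed.

(** * Splitting off the first digit *)

(** A string is empty or has a first digit. *)
Lemma esum_string_cons (R : realType) b (S : set (string b))
    (g : string b -> \bar R) : (forall X, 0 <= g X)%E ->
  \esum_(X in S) g X = ((if [::] \in S then g [::] else 0) +
    \sum_(a < b) \esum_(X in [set X | S (a :: X)]) g (a :: X))%E.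
Proof.
move=> g0.
have split_head X : g X = ((if X \in [set [::]] then g X else 0) +
    \sum_(a < b) if X \in range (cons a) then g X else 0)%E.
  case: X => [|a X].
    rewrite mem_set// big1 ?adde0// => a _.
    by rewrite memNset// => -[].
  rewrite memNset//= add0e (bigD1 a)//= mem_set; last by exists X.
  rewrite big1 ?adde0// => a' /eqP a'a; rewrite memNset// => -[Y _ [e _]].
  by rewrite e in a'a.
rewrite (eq_esum (fun X _ => split_head X)) esumD; last 2 first.
- by move=> X _; case: ifP.
- by move=> X _; apply: sume_ge0 => a _; case: ifP.
rewrite esum_sum; last by move=> X a _ _; case: ifP.
congr (_ + _)%E.
  rewrite -esum_mkcondr; case: ifPn => nS.
    rewrite setIidr ?esum_set1// => X /= ->; exact: set_mem.
  rewrite (_ : _ `&` _ = set0) ?esum_set0//.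
  apply/seteqP; split=> X //= [SX Xn]; move: nS.
  by rewrite notin_setE -Xn.
apply: eq_bigr => a _; rewrite -esum_mkcondr.
rewrite -(@esum_image _ _ _ _ (cons a) g); last first.
  by move=> X Y _ _ [].
congr esum; apply/seteqP; split=> X /=.
  by move=> [SX [Y _ YX]]; exists Y => //; rewrite YX.
by move=> [Y SY <-]; split=> //; exists Y.
Qed.

Section strsum_theory.
Context (R : realType) (b d : nat).
Hypotheses (b_gt1 : (1 < b)%N) (d_lt_b : (d < b)%N).
Implicit Types (f g : R -> R) (k : nat) (Q : pred nat).

(** The class of integrands: nonnegativity lets the sums be rearranged freely,
    and boundedness makes them finite. Only [0, 1) matters, since it carries
    [mu_k]. *)
Definition unit_bounded (f : R -> R) :=
  exists C, forall x, 0 <= x < 1 -> 0 <= f x <= C.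

(** Putting [a] in front of a string [X] turns [x(X)] into [(a + x(X)) / b]. *)
Definition pull_digit (a : nat) (f : R -> R) : R -> R :=
  fun x => f ((a%:R + x) / b%:R).

Let str_real01 (X : string b) : 0 <= str_real R X < 1.
Proof. by rewrite str_real_ge0 str_real_lt1. Qed.

Let b_gt0 : 0 < b%:R :> R. Proof. by rewrite ltr0n ltnW. Qed.

Let wt_ge0 (X : string b) : 0 <= b%:R ^- size X :> R.
Proof. by rewrite invr_ge0 exprn_ge0. Qed.

Let term_ge0 f (X : string b) : (forall x, 0 <= x < 1 -> 0 <= f x) ->
  (0 <= (b%:R ^- size X * f (str_real R X))%:E)%E.
Proof. by move=> f0; rewrite lee_fin mulr_ge0// f0. Qed.

Lemma prepend_digit01 a (x : R) : (a < b)%N -> 0 <= x < 1 ->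
  0 <= (a%:R + x) / b%:R < 1.
Proof.
move=> ab /andP[x0 x1]; rewrite divr_ge0 ?addr_ge0//=.
rewrite ltr_pdivrMr// mul1r (@lt_le_trans _ _ (a%:R + 1))// ?ltrD2l//.
by rewrite natr1 ler_nat.
Qed.

Lemma pull_digit_ge0 a f : (a < b)%N -> (forall x, 0 <= x < 1 -> 0 <= f x) ->
  forall x, 0 <= x < 1 -> 0 <= pull_digit a f x.
Proof. by move=> ab f0 x x01; exact/f0/prepend_digit01. Qed.

Lemma pull_digit_bounded a f : (a < b)%N ->
  unit_bounded f -> unit_bounded (pull_digit a f).
Proof. by move=> ab [C fC]; exists C => x x01; exact/fC/prepend_digit01. Qed.

(** Self-similarity of the measures: splitting off the first digit expresses
    [mu_k] through the images of [mu_k] (first digit other than [d]) and of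
    [mu_(k-1)] (first digit [d]) under the contractions [x -> (a + x) / b]; the
    empty string contributes only when [k = 0]. *)
Lemma strsum_cons Q k f : (forall x, 0 <= x < 1 -> 0 <= f x) ->
  strsum b d Q k f =
  ((if (k == 0%N) && Q 0%N then f 0 else 0)%:E
   + \sum_(a < b | (a != d :> nat))
       (b%:R^-1)%:E * strsum b d (fun l => Q l.+1) k (pull_digit a f)
   + (if k is k'.+1 then
       (b%:R^-1)%:E * strsum b d (fun l => Q l.+1) k' (pull_digit d f)
      else 0))%E.
Proof.
move=> f0; have gT X := term_ge0 X f0.
have b0 : (b%:R : R) != 0 by rewrite gt_eqF.
have consE (a : 'I_b) (X : string b) :
    (b%:R ^- size (a :: X) * f (str_real R (a :: X)))%:E
    = (b%:R^-1%:E * (b%:R ^- size X * pull_digit a f (str_real R X))%:E)%E.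
  rewrite /= str_real_cons -EFinM /pull_digit; congr EFin.
  by rewrite mulrA -invfM -exprS.
have gT' (a : 'I_b) X := term_ge0 X (pull_digit_ge0 (ltn_ord a) f0).
rewrite /strsum esum_string_cons// -addeA; congr (_ + _)%E.
  rewrite str_real_nil expr0 invr1 mul1r.
  have -> : ([::] \in [set X : string b | occ d X = k /\ Q (size X)])
      = (k == 0%N) && Q 0%N.
    apply/idP/idP; rewrite inE/= /occ/=; first by move=> [<- ->].
    by move=> /andP[/eqP-> ->].
  by case: ifP.
rewrite (bigD1 (Ordinal d_lt_b))//= addeC; congr (_ + _)%E.
  apply: eq_bigr => a ad; rewrite -(esumZ _ (gT' a)) ?invr_ge0 ?ltW//.
  have adN : (a != d :> nat) by [].
  rewrite (eq_esum (fun X _ => consE a X)).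
  congr esum; apply/seteqP; split=> X /=.
    by rewrite /occ/= (negPf adN).
  by rewrite /occ/= (negPf adN).
rewrite (eq_esum (fun X _ => consE (Ordinal d_lt_b) X)).
case: k => [|k].
  rewrite (_ : [set _ | _] = set0) ?esum_set0//.
  by apply/seteqP; split=> X //=; rewrite /occ/= eqxx => -[].
rewrite -(esumZ _ (gT' (Ordinal d_lt_b))) ?invr_ge0 ?ltW//.
congr esum; apply/seteqP; split=> X /=; rewrite /occ/= eqxx add1n.
  by move=> [[->]].
by move=> [->].
Qed.

Lemma sum_neq_d (c : R) :
  \sum_(a < b | (a != d :> nat)) c = (b%:R - 1) * c.
Proof.
apply: (addrI c); transitivity (\sum_(a < b) c).
  by rewrite [RHS](bigD1 (Ordinal d_lt_b)).
by rewrite sumr_const card_ord -mulr_natl; ring.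
Qed.

(** The total mass [b] is a fixed point of the recursion on the first digit,
    for [k = 0] as [1 + (b - 1) = b] and for larger [k] as [(b - 1) + 1 = b];
    hence the bound [b] propagates from length to length. *)
Lemma strsum_lt_size_le L k :
  (strsum b d (ltn^~ L) k (fun=> 1%R) <= (b%:R : R)%:E)%E.
Proof.
elim: L k => [|L IH] k.
  rewrite /strsum (_ : [set _ | _] = set0) ?esum_set0 ?lee_fin ?ltW//.
  by apply/seteqP; split=> X //= [_].
rewrite strsum_cons//.
have le1 j : ((b%:R^-1)%:E * strsum b d (fun l => l.+1 < L.+1)%N j (fun=> 1%R)
    <= (1%R : R)%:E)%E.
  apply: le_trans (lee_wpmul2l _ (IH j)) _.
    by rewrite lee_fin invr_ge0 ltW.
  by rewrite -EFinM mulVf ?gt_eqF.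
have leS : (\sum_(a < b | (a != d :> nat)) ((b%:R^-1)%:E *
    strsum b d (fun l => l.+1 < L.+1)%N k (pull_digit a (fun=> 1%R))) <=
    (b%:R - 1 : R)%R%:E)%E.
  apply: (@le_trans _ _ (\sum_(a < b | (a != d :> nat)) (1%R : R)%:E)%E).
    by apply: lee_sum => a _; exact: le1.
  by rewrite sumEFin sum_neq_d mulr1.
case: k leS => [|k] leS /=.
  rewrite adde0; apply: le_trans (leeD2l _ leS) _.
  by rewrite -EFinD lee_fin addrC subrK.
rewrite add0e; apply: le_trans (leeD leS (le1 k)) _.
by rewrite -EFinD lee_fin subrK.
Qed.

(** A finite set of strings has bounded lengths. *)
Lemma strsum1_le k : (strsum b d predT k (fun=> 1%R) <= (b%:R : R)%:E)%E.
Proof.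
apply: ge_ereal_sup => _ [F [finF FS] <-].
have /finite_seqP[A FA] := finF.
apply: le_trans _ (strsum_lt_size_le (\max_(X <- A) size X)%N.+1 k).
apply: esum_ge; exists F => //; split=> // X FX; have [Xk _] := FS _ FX.
split=> //; rewrite /= ltnS; apply: leq_bigmax_seq => //.
by move: FX; rewrite FA.
Qed.

Definition integ k f : R := fine (strsum b d predT k f).

Lemma strsum_ge0 k f : (forall x, 0 <= x < 1 -> 0 <= f x) ->
  (0 <= strsum b d predT k f)%E.
Proof. by move=> f0; apply: esum_ge0 => X _; exact: term_ge0. Qed.

Lemma strsum_fin_num k f : unit_bounded f ->
  strsum b d predT k f \is a fin_num.
Proof.
move=> [C fC].
have f0 x : 0 <= x < 1 -> 0 <= f x by move=> /fC/andP[].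
have C0 : 0 <= C.
  have /fC/andP[] : 0 <= (0 : R) < 1 by rewrite lexx ltr01.
  exact: le_trans.
rewrite ge0_fin_numE ?strsum_ge0//.
apply: (@le_lt_trans _ _ (C * b%:R)%:E); last exact: ltry.
rewrite EFinM (le_trans _ (lee_wpmul2l _ (strsum1_le k)))//.
rewrite /strsum -esumZ//.
apply: le_esum => X _; rewrite mulr1 -EFinM lee_fin mulrC ler_wpM2r//.
by have /andP[] := fC _ (str_real01 X).
Qed.

Lemma integK k f : unit_bounded f -> strsum b d predT k f = (integ k f)%:E.
Proof. by move=> fb; rewrite fineK// strsum_fin_num. Qed.

Lemma unit_bounded_ge0 f : unit_bounded f -> forall x, 0 <= x < 1 -> 0 <= f x.
Proof. by move=> [C fC] x /fC/andP[]. Qed.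

Lemma integ_cons k f : unit_bounded f ->
  integ k f = (k == 0%N)%:R * f 0
   + b%:R^-1 * \sum_(a < b | (a != d :> nat)) integ k (pull_digit a f)
   + (0 < k)%N%:R * (b%:R^-1 * integ k.-1 (pull_digit d f)).
Proof.
move=> fb; have f0 := unit_bounded_ge0 fb.
apply: EFin_inj; rewrite -integK// strsum_cons// !EFinD; congr (_ + _ + _)%E.
- by rewrite andbT; case: eqP => _; rewrite ?mul1r ?mul0r.
- rewrite mulr_sumr -sumEFin; apply: eq_bigr => a _.
  by rewrite EFinM -integK//; exact: pull_digit_bounded.
- case: k => [|k]; first by rewrite mul0r.
  by rewrite mul1r EFinM -integK//; exact: pull_digit_bounded.
Qed.

Lemma eq_integ k f g : (forall x, 0 <= x < 1 -> f x = g x) ->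
  integ k f = integ k g.
Proof.
by move=> fg; congr fine; apply: eq_esum => X _; rewrite fg ?str_real01.
Qed.

Lemma integ_ge0 k f : (forall x, 0 <= x < 1 -> 0 <= f x) -> 0 <= integ k f.
Proof. by move=> f0; rewrite fine_ge0// strsum_ge0. Qed.

Lemma integD k f g : unit_bounded f -> unit_bounded g ->
  integ k (fun x => f x + g x) = integ k f + integ k g.
Proof.
move=> fb gb; have f0 := unit_bounded_ge0 fb; have g0 := unit_bounded_ge0 gb.
rewrite -fineD ?strsum_fin_num//; congr fine; rewrite -esumD.
- by apply: eq_esum => X _; rewrite -EFinD mulrDr.
- by move=> X _; exact: term_ge0.
- by move=> X _; exact: term_ge0.
Qed.

Lemma integZ k c f : 0 <= c -> unit_bounded f ->
  integ k (fun x => c * f x) = c * integ k f.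
Proof.
move=> c0 fb; have f0 := unit_bounded_ge0 fb.
apply: EFin_inj; rewrite EFinM -!integK//.
  rewrite /strsum -esumZ//; last by move=> X; exact: term_ge0.
  by apply: eq_esum => X _; rewrite -EFinM mulrCA.
case: fb => C fC; exists (c * C) => x /fC/andP[f0x fCx].
by rewrite mulr_ge0 ?ler_wpM2l.
Qed.

Lemma le_integ k f g : (forall x, 0 <= x < 1 -> 0 <= f x <= g x) ->
  unit_bounded g -> integ k f <= integ k g.
Proof.
move=> fg gb; have fb : unit_bounded f.
  case: gb => C gC; exists C => x x01.
  have /andP[-> h] := fg _ x01; have /andP[_ h'] := gC _ x01.
  exact: le_trans h'.
rewrite -lee_fin -!integK//; apply: le_esum => X _.
by rewrite lee_fin ler_wpM2l//; have /andP[] := fg _ (str_real01 X).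
Qed.

Lemma unit_bounded_cst c : 0 <= c -> unit_bounded (fun=> c).
Proof. by move=> c0; exists c => x _; rewrite c0 lexx. Qed.

(** Once finite, the masses are determined by the recursion on the first digit,
    which reads [M_0 = 1 + (b - 1) / b * M_0] and [M_k = (b - 1) / b * M_k +
    M_(k-1) / b]. *)
Lemma integ1 k : integ k (fun=> 1) = b%:R.
Proof.
have b0 : (b%:R : R) != 0 by rewrite gt_eqF.
elim: k => [|k IH].
  have := @integ_cons 0 (fun=> 1) (unit_bounded_cst ler01).
  rewrite (eq_bigr (fun=> integ 0 (fun=> 1)))// sum_neq_d.
  rewrite mul1r mul0r addr0 => h.
  have {}h : b%:R * integ 0 (fun=> 1) = b%:R + (b%:R - 1) * integ 0 (fun=> 1).
    rewrite {1}h mulrDr mulr1; congr (_ + _).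
    by rewrite mulrA mulfV ?mul1r.
  lra.
have := @integ_cons k.+1 (fun=> 1) (unit_bounded_cst ler01).
rewrite (eq_bigr (fun=> integ k.+1 (fun=> 1)))// sum_neq_d mul0r add0r mul1r.
rewrite [integ k (pull_digit d _)]IH mulVf// => h.
have {}h : b%:R * integ k.+1 (fun=> 1) =
    (b%:R - 1) * integ k.+1 (fun=> 1) + b%:R.
  rewrite {1}h mulrDr mulr1; congr (_ + _).
  by rewrite mulrA mulfV ?mul1r.
lra.
Qed.
End strsum_theory.

(** * Integers as strings of digits *)

Lemma digits_lt b m : (1 < b)%N -> (0 < m < b)%N -> digits b m = [:: m].
Proof.
move=> b1 /andP[m0 mb]; rewrite /digits (trunc_log_eq (n := 0))//=.
  by rewrite divn1 modn_small.
by rewrite expn0 expn1 m0.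
Qed.

(** The recursion on the last digit; together with [digits_lt] it characterizes
    [digits]. *)
Lemma digits_mulDr b q a : (1 < b)%N -> (0 < q)%N -> (a < b)%N ->
  digits b (b * q + a) = a :: digits b q.
Proof.
move=> b1 q0 ab.
have divE : ((b * q + a) %/ b = q)%N.
  by rewrite mulnC divnMDl ?divn_small ?addn0// ltnW.
rewrite /digits.
have -> : trunc_log b (b * q + a) = (trunc_log b q).+1.
  have /andP[h1 h2] := trunc_log_bounds b1 q0.
  apply: trunc_log_eq => //; rewrite !expnS in h2 *.
  rewrite (leq_trans _ (leq_addr _ _)) ?leq_mul2l ?h1 ?orbT//=.
  rewrite (leq_trans (n := b * q.+1))//; first by rewrite mulnS addnC ltn_add2r.
  by rewrite leq_mul2l h2 orbT.
set t := trunc_log b q.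
rewrite [iota 0 t.+2]/= -/(iota 1 t.+1) [in LHS]map_cons.
rewrite (iotaDl 1 0) -map_comp; congr cons.
  by rewrite expn0 divn1 mulnC modnMDl modn_small.
by apply: eq_map => i /=; rewrite expnS divnMA divE.
Qed.

Lemma digits_str_nat b (a : 'I_b) (X : string b) : (1 < b)%N -> (0 < a)%N ->
  (0 < str_nat (a :: X))%N /\
  digits b (str_nat (a :: X)) = rev (map val (a :: X)).
Proof.
move=> b1 a0; elim/last_ind: X => [|X c [IH1 IH2]].
  rewrite /str_nat big_ord1/= expn0 muln1; split=> //.
  by rewrite digits_lt// a0 ltn_ord.
rewrite -rcons_cons str_nat_rcons; split.
  by rewrite addn_gt0 muln_gt0 IH1 ltnW.
by rewrite digits_mulDr// IH2 map_rcons rev_rcons.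
Qed.

Lemma exists_str_nat b m : (1 < b)%N -> (0 < m)%N ->
  exists (a : 'I_b) (X : string b), (0 < a)%N /\ str_nat (a :: X) = m.
Proof.
move=> b1; elim/ltn_ind: m => m IH m0.
have [mb|bm] := ltnP m b.
  exists (Ordinal mb), [::]; split=> //.
  by rewrite /str_nat big_ord1/= expn0 muln1.
have [||a [X [a0 XE]]] := IH (m %/ b)%N.
- by rewrite ltn_Pdiv.
- by rewrite divn_gt0// ltnW.
have mb : (m %% b < b)%N by rewrite ltn_mod ltnW.
exists a, (rcons X (Ordinal mb)); split=> //.
by rewrite -rcons_cons str_nat_rcons XE mulnC -divn_eq.
Qed.

(** Positive integers correspond bijectively to the strings with a nonzero
    first digit. *)
Lemma irwin_sum_strings (R : realType) b d k : (1 < b)%N ->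
  irwin_sum R b d k =
  \esum_(X in [set X : string b | occ d X = k /\ (0 < head 0 (map val X))%N])
    ((str_nat X)%:R^-1)%:E.
Proof.
move=> b1; rewrite /irwin_sum.
rewrite eseries_cond nneseries_esum; last by move=> n _; rewrite lee_fin.
apply: reindex_esum; split.
- move=> [|a X] [<- a0] //; have [pos digE] := digits_str_nat X b1 a0.
  apply/andP; split=> //; apply/eqP.
  by rewrite digE count_rev.
- move=> X Y /set_mem[_ X0] /set_mem[_ Y0].
  case: X Y X0 Y0 => [|a X] [|c Y]//= a0 c0 /(congr1 (digits b)).
  have [_ ->] := digits_str_nat X b1 a0; have [_ ->] := digits_str_nat Y b1 c0.
  by move/(can_inj revK)/(inj_map val_inj).
- move=> m /andP[/eqP mk m0].
  have [a [X [a0 XE]]] := exists_str_nat b1 m0.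
  exists (a :: X) => //; split=> //.
  have [_] := digits_str_nat X b1 a0.
  by rewrite XE => mE; rewrite -mk mE count_rev.
Qed.

(** * Sums of inverses over the extensions of an integer *)

Definition inv_shift (R : realType) (n : nat) : R -> R :=
  fun x => (n%:R + x)^-1.

Lemma inv_shift_bounded (R : realType) n : (0 < n)%N ->
  unit_bounded (@inv_shift R n).
Proof.
move=> n0; exists 1 => x /andP[x0 _]; rewrite /inv_shift.
have n1 : 1 <= n%:R :> R by rewrite ler1n.
by rewrite invr_ge0 addr_ge0//= invf_le1; lra.
Qed.

Lemma pull_digit_inv_shift (R : realType) b a n x : (0 < b)%N ->
  pull_digit b a (@inv_shift R n) x = b%:R * inv_shift (b * n + a) x.
Proof.
move=> b0; have bN0 : b%:R != 0 :> R by rewrite pnatr_eq0 -lt0n.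
rewrite /pull_digit /inv_shift natrD natrM -{2}[b%:R]invrK -invfM; congr _^-1.
by field.
Qed.

(** As [b ^ (- l) / (n + x(X)) = 1 / (n * b ^ l + n(X))] for [X] of length [l],
    this is the sum of [1 / m] over the integers [m] that consist of [n]
    followed by a string with [k] occurrences of [d]. *)
Definition tail (R : realType) b d k n : R := integ b d k (inv_shift n).

(** Split the integers extending [n] by the digit that follows [n]. *)
Lemma tail_rec (R : realType) b d k n : (1 < b)%N -> (d < b)%N -> (0 < n)%N ->
  tail R b d k n = (k == 0%N)%:R / n%:R
    + \sum_(0 <= a < b | (a != d)) tail R b d k (b * n + a)
    + (0 < k)%N%:R * tail R b d k.-1 (b * n + d).
Proof.
move=> b1 db n0; have b0 := ltnW b1.
have bn0 a : (0 < b * n + a)%N by rewrite addn_gt0 muln_gt0 b0 n0.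
have bN0 : b%:R != 0 :> R by rewrite pnatr_eq0 -lt0n.
have pullE j a : integ b d j (pull_digit b a (@inv_shift R n))
    = b%:R * tail R b d j (b * n + a).
  rewrite -integZ//; last exact: inv_shift_bounded.
  by apply: eq_integ => x _; exact: pull_digit_inv_shift.
rewrite {1}/tail (integ_cons b1 db _ (inv_shift_bounded R n0)).
rewrite /inv_shift addr0 -/(inv_shift n) pullE mulKf//; congr (_ + _ + _).
rewrite big_mkord mulr_sumr; apply: eq_bigr => a _.
by rewrite pullE mulKf.
Qed.

(** Split the integers according to their first digit: the digit [d] already
    uses one of the [k] occurrences. *)
Lemma irwin_sum_tail (R : realType) b d k : (1 < b)%N -> (0 < d < b)%N ->
  (0 < k)%N ->
  irwin_sum R b d k = (\sum_(1 <= a < b) tail R b d k a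
                       - tail R b d k d + tail R b d k.-1 d)%:E.
Proof.
move=> b1 /andP[d0 db] k0; have b0 := ltnW b1.
rewrite irwin_sum_strings// esum_string_cons; last by move=> X; rewrite lee_fin.
rewrite memNset ?add0e; last by move=> [].
have tailE j (a : 'I_b) : (0 < a)%N ->
    \esum_(X in [set X : string b | occ d X = j]) ((str_nat (a :: X))%:R^-1)%:E
    = (tail R b d j a)%:E.
  move=> a0; rewrite -integK//; last exact: inv_shift_bounded.
  rewrite /strsum; have -> : [set X : string b | occ d X = j] =
    [set X : string b | occ d X = j /\ predT (size X)].
    by apply/seteqP; split=> X //= [].
  apply: eq_esum => X _; congr EFin.
  rewrite -invfM /inv_shift; congr _^-1.
  rewrite str_nat_cons natrD natrM natrX /str_real.
  have := expf_neq0 (size X) (_ : b%:R != 0 :> R) => /(_ _)bN0.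
  by field; rewrite bN0// pnatr_eq0 -lt0n.
(* The truncated [k - (a == d)] is the number of occurrences left after [a]. *)
have termE (a : 'I_b) : \esum_(X in [set X : string b |
      [set X | occ d X = k /\ (0 < head 0 (map val X))%N] (a :: X)])
      ((str_nat (a :: X))%:R^-1)%:E =
    (if (0 < a)%N then tail R b d (k - (a == d :> nat)) a else 0)%:E.
  case: ifPn => a0; last first.
    rewrite (_ : [set _ | _] = set0) ?esum_set0//.
    by apply/seteqP; split=> X //= []; rewrite (negPf a0).
  rewrite -tailE//; congr esum; apply/seteqP; split=> X /=.
    by rewrite /occ/= => -[<- _]; rewrite addKn.
  rewrite /occ/= => ->; rewrite subnKC//.
  by case: eqP.
rewrite (eq_bigr _ (fun a _ => termE a)) sumEFin; congr EFin.
rewrite -(big_mkord xpredT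
  (fun a => if (0 < a)%N then tail R b d (k - (a == d)) a else 0)).
rewrite big_ltn//= add0r.
rewrite big_nat (eq_bigr (fun a => tail R b d (k - (a == d)) a)); last first.
  by move=> a /andP[-> _].
rewrite -big_nat !(bigD1_seq d)/= ?mem_index_iota ?d0 ?iota_uniq//.
rewrite eqxx subn1 (eq_bigr (tail R b d k)); first by ring.
by move=> a /negPf ->; rewrite subn0.
Qed.

(** * Expansion in terms of the moments *)

Section expansion.
Context (R : realType) (b d : nat).
Hypotheses (b_gt1 : (1 < b)%N) (d_lt_b : (d < b)%N).
Local Notation u := (moment R b d).

Let b_gt0 : 0 < b%:R :> R. Proof. by rewrite ltr0n ltnW. Qed.

(** The remainder in the expansion of [tail] in inverse powers of [n], from the
    finite geometric series for [1 / (n + x)]. *)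
Definition tail_rem k n M : R := integ b d k (fun x => x ^+ M * inv_shift n x).

Lemma expr_inv_shift_le n M (x : R) : (0 < n)%N -> 0 <= x < 1 ->
  0 <= x ^+ M * inv_shift n x <= n%:R^-1.
Proof.
move=> n0 /andP[x0 x1]; have nR : 0 < n%:R :> R by rewrite ltr0n.
have i0 : 0 <= inv_shift n x by rewrite invr_ge0 addr_ge0// ltW.
rewrite mulr_ge0 ?exprn_ge0//=.
apply: (@le_trans _ _ (1 * inv_shift n x)).
  by rewrite ler_wpM2r// exprn_ile1// ltW.
by rewrite mul1r lef_pV2 ?posrE ?ltr_wpDr// lerDl.
Qed.

Lemma expr_inv_shift_bounded n M : (0 < n)%N ->
  unit_bounded (fun x : R => x ^+ M * inv_shift n x).
Proof. by move=> n0; exists n%:R^-1 => x; exact: expr_inv_shift_le. Qed.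

Lemma integ_cst k (c : R) : 0 <= c -> integ b d k (fun=> c) = c * b%:R.
Proof.
move=> c0; rewrite -(integ1 R b_gt1 d_lt_b k) -integZ//; last first.
  exact: unit_bounded_cst.
by apply: eq_integ => x _; rewrite mulr1.
Qed.

Lemma tail_rem_bounds k n M : (0 < n)%N ->
  0 <= tail_rem k n M <= b%:R / n%:R.
Proof.
move=> n0; apply/andP; split.
  by apply: integ_ge0 => x /(expr_inv_shift_le M n0)/andP[].
rewrite mulrC -(integ_cst k) ?invr_ge0//; apply: le_integ => //.
  by move=> x; exact: expr_inv_shift_le.
by apply: unit_bounded_cst; rewrite invr_ge0.
Qed.

(** The measure has mass [b] and [1 / (n + x)] lies between [1 / (n + 1)] and
    [1 / n]. *)
Lemma tail_bounds k n : (0 < n)%N ->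
  b%:R / n.+1%:R <= tail R b d k n <= b%:R / n%:R.
Proof.
move=> n0; have /andP[_] := tail_rem_bounds k 0 n0.
rewrite /tail_rem (@eq_integ _ _ _ k _ (inv_shift n)); last first.
  by move=> x _; rewrite expr0 mul1r.
move=> ->; rewrite andbT mulrC -(integ_cst k) ?invr_ge0//.
apply: le_integ => //; last exact: inv_shift_bounded.
move=> x /andP[x0 x1]; rewrite invr_ge0 ler0n/= /inv_shift.
have n0R : 0 < n%:R :> R by rewrite ltr0n.
by rewrite lef_pV2 ?posrE ?ltr_wpDr// -natr1 lerD2l ltW.
Qed.

(** Integrate [x ^ M = n * x ^ M / (n + x) + x ^ (M + 1) / (n + x)]. Both terms
    on the right are nonnegative, so no signed integrand is needed to unfold
    the alternating expansion. *)
Lemma moment_tail_rem k n M : (0 < n)%N ->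
  u k M = n%:R * tail_rem k n M + tail_rem k n M.+1.
Proof.
move=> n0; have nR : 0 < n%:R :> R by rewrite ltr0n.
have bn := expr_inv_shift_bounded _ n0.
rewrite momentE /tail_rem -integZ// -integD//; last first.
  exists 1 => x x01; have /andP[h0 h1] := expr_inv_shift_le M n0 x01.
  rewrite (mulr_ge0 (ltW nR) h0)/=.
  by apply: le_trans (ler_wpM2l (ltW nR) h1) _; rewrite divff ?gt_eqF.
apply: eq_integ => x /andP[x0 x1]; rewrite /inv_shift exprS.
by field; rewrite gt_eqF// ltr_wpDr.
Qed.

Lemma moment0 k : u k 0%N = b%:R.
Proof.
rewrite momentE -[RHS](integ1 R b_gt1 d_lt_b k).
by apply: eq_integ => x _; rewrite expr0.
Qed.

Lemma tail_expansion k n M : (0 < n)%N -> (0 < M)%N ->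
  tail R b d k n = b%:R / n%:R
    - \sum_(1 <= m < M) (-1) ^+ m.-1 * (u k m / n%:R ^+ m.+1)
    + (-1) ^+ M * (tail_rem k n M / n%:R ^+ M).
Proof.
move=> n0; have nR : n%:R != 0 :> R by rewrite pnatr_eq0 -lt0n.
elim: M => // M IH _; case: M IH => [_|M IH].
  rewrite big_geq// subr0 -(moment0 k) (moment_tail_rem k 0 n0).
  rewrite /tail_rem (@eq_integ _ _ _ k (fun x => x ^+ 0 * inv_shift n x)
    (inv_shift n)); last first.
    by move=> x _; rewrite expr0 mul1r.
  by rewrite -/(tail R b d k n) !expr1; field.
rewrite {}IH// [in RHS]big_nat_recr//= (moment_tail_rem k M.+1 n0).
rewrite [in RHS]exprS.
have := expf_neq0 M.+2 nR; have := expf_neq0 M.+1 nR => h1 h2.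
rewrite !exprS; field.
by rewrite expf_neq0.
Qed.

End expansion.

(** * Summation of expansions *)

Section series.
Context (R : realType).

Lemma cvg_sumr (I : Type) (r : seq I) (P : pred I) (f : I -> nat -> R)
    (l : I -> R) :
  (forall i, P i -> f i @ \oo --> l i) ->
  (fun N => \sum_(i <- r | P i) f i N) @ \oo --> \sum_(i <- r | P i) l i.
Proof.
move=> fl; elim: r => [|i r IH].
  by rewrite big_nil; under eq_fun do rewrite big_nil; exact: cvg_cst.
rewrite big_cons; under eq_fun do rewrite big_cons; case: ifPn => // Pi.
by apply: cvgD => //; exact: fl.
Qed.

Lemma cvg_geometric_dist (x : nat -> R) (l C : R) : 0 <= C ->
  (forall M, (0 < M)%N -> `|l - x M| <= C * 2^-1 ^+ M) -> x @ \oo --> l.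
Proof.
move=> C0 xl; apply/cvgrPdist_le => e e0.
have : geometric C (2^-1 : R) @ \oo --> 0.
  by apply: cvg_geometric; rewrite ger0_norm ?invr_ge0// invf_lt1 ?ltr1n.
move=> /cvgrPdist_le/(_ e e0)[N _ HN]; exists N.+1 => // M /= NM.
have M0 : (0 < M)%N by exact: leq_ltn_trans NM.
apply: le_trans (xl _ M0) _; have /= := HN M (ltnW NM).
by rewrite sub0r normrN ger0_norm// mulr_ge0// exprn_ge0// invr_ge0.
Qed.

Lemma is_cvg_bounded_sum (c : nat -> R) (K : R) :
  (forall n, (0 < n)%N -> 0 <= c n) ->
  (forall N, \sum_(1 <= n < N) c n <= K) ->
  cvgn (fun N => \sum_(1 <= n < N) c n).
Proof.
move=> c0 cK; apply: nondecreasing_is_cvgn; last first.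
  by exists K => _ [N _ <-].
apply/nondecreasing_seqP => -[|N].
  by rewrite !big_geq.
by rewrite [leRHS]big_nat_recr//= lerDl c0.
Qed.

Lemma is_cvg_dominated_sum (a c : nat -> R) (K : R) :
  (forall n, (0 < n)%N -> `|a n| <= c n) ->
  (forall N, \sum_(1 <= n < N) c n <= K) ->
  cvgn (fun N => \sum_(1 <= n < N) a n).
Proof.
move=> ac cK.
have c0 n : (0 < n)%N -> 0 <= c n by move=> /ac; exact: le_trans.
have -> : (fun N => \sum_(1 <= n < N) a n) =
    (fun N => \sum_(1 <= n < N) (a n + c n))
    \- (fun N => \sum_(1 <= n < N) c n).
  by apply/funext => N /=; rewrite big_split/= addrK.
(* [a + c] is nonnegative and bounded by [c + c]. *)
apply: is_cvgB; last exact: is_cvg_bounded_sum cK.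
apply: (@is_cvg_bounded_sum _ (K + K)) => [n n0|N].
  by have := ac _ n0; rewrite ler_norml => /andP[]; rewrite -subr_ge0 opprK.
rewrite big_split/= lerD//; apply: le_trans (cK N).
rewrite big_nat [leRHS]big_nat; apply: ler_sum => n /andP[n0 _].
exact: le_trans (ler_norm _) (ac _ n0).
Qed.

(** A quantitative form of [G n = sum_(m >= 1) e m / n ^ (m + 1)]: the bound on
    the remainder is summable in [n], which lets sums over [n] and [m] be
    exchanged without double series. *)
Definition has_expansion (B : R) (e G : nat -> R) := forall n M : nat,
  (0 < n)%N -> (0 < M)%N ->
  `|G n - \sum_(1 <= m < M) e m / n%:R ^+ m.+1| <= B / n%:R ^+ M.+1.

Lemma inv_expr_le2 n m : (1 < n)%N ->
  (n%:R ^+ m)^-1 <= 2^-1 ^+ m :> R.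
Proof.
move=> n1; rewrite -exprVn lerXn2r ?nnegrE ?invr_ge0//.
by rewrite lef_pV2 ?posrE ?ltr0n ?ler_nat// ltnW.
Qed.

Lemma cvg_expansion B e G n : 0 <= B -> has_expansion B e G -> (1 < n)%N ->
  (fun M => \sum_(1 <= m < M) e m / n%:R ^+ m.+1) @ \oo --> G n.
Proof.
move=> B0 eG n1; apply: (@cvg_geometric_dist _ _ B) => // M M0.
apply: le_trans (eG _ _ (ltnW n1) M0) _; rewrite ler_wpM2l//.
apply: le_trans (inv_expr_le2 _ n1) _.
by rewrite exprS ger_pMl ?exprn_gt0 ?invr_gt0// invf_le1 ?ler1n.
Qed.

Context (q : nat -> nat).
Hypotheses (qS : forall n, (n < q n)%N).

(** As [q n >= n + 1], compare with the telescoping [1 / n - 1 / (n + 1)]. *)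
Lemma sum_inv_sqr_le1 N : \sum_(1 <= n < N) ((q n)%:R ^+ 2)^-1 <= 1 :> R.
Proof.
case: N => [|N]; first by rewrite big_geq.
apply: (@le_trans _ _
    (\sum_(1 <= n < N.+1) (- (n.+1%:R)^-1 - - (n%:R)^-1 : R))).
  rewrite big_nat [leRHS]big_nat; apply: ler_sum => n /andP[n0 _].
  have nR : 0 < n%:R :> R by rewrite ltr0n.
  have n1R : n%:R + 1 <= (q n)%:R :> R by rewrite natr1 ler_nat.
  rewrite -natr1.
  have -> : - (n%:R + 1)^-1 - - n%:R^-1 = (n%:R * (n%:R + 1))^-1 :> R.
    by field; rewrite !gt_eqF// ltr_wpDr.
  have q0 : 0 < (q n)%:R :> R by lra.
  have nn0 : 0 < n%:R * (n%:R + 1) :> R by rewrite mulr_gt0//; lra.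
  by rewrite lef_pV2 ?posrE ?exprn_gt0//; nra.
rewrite (telescope_sumr (fun n => - (n%:R)^-1))//.
by rewrite invr1 opprK gerDr oppr_le0 invr_ge0.
Qed.

Lemma inv_expr_le_sqr n m : (1 <= m)%N -> (0 < n)%N ->
  ((q n)%:R ^+ m.+1)^-1 <= ((q n)%:R ^+ 2)^-1 * 2^-1 ^+ m.-1 :> R.
Proof.
case: m => //= m _ n0; have q1 := leq_ltn_trans n0 (qS n).
rewrite -[m.+2]addn2 exprD invfM mulrC ler_wpM2l ?invr_ge0 ?exprn_ge0//.
exact: inv_expr_le2.
Qed.

Lemma is_cvg_sum_inv_expr m : (1 <= m)%N ->
  cvgn (fun N => \sum_(1 <= n < N) 1 / (q n)%:R ^+ m.+1 : R).
Proof.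
move=> m1; apply: (@is_cvg_dominated_sum _ _ 1 _ sum_inv_sqr_le1) => n n0.
rewrite mul1r ger0_norm ?invr_ge0 ?exprn_ge0//.
apply: le_trans (inv_expr_le_sqr m1 n0) _.
by rewrite ger_pMr ?invr_gt0 ?exprn_gt0 ?ltr0n ?(leq_ltn_trans _ (qS n))//
  exprn_ile1 ?invr_ge0// invf_le1 ?ler1n.
Qed.

(** For [M = 1] the expansion says that [G n] is at most [B / n ^ 2] in
    absolute value. *)
Lemma is_cvg_sum_expansion B e G : 0 <= B -> has_expansion B e G ->
  cvgn (fun N => \sum_(1 <= n < N) G (q n)).
Proof.
move=> B0 eG.
apply: (@is_cvg_dominated_sum _ (fun n => B * ((q n)%:R ^+ 2)^-1) B)
  => [n n0|N].
  have q0 := leq_ltn_trans (leq0n n) (qS n).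
  have := eG _ 1%N q0 isT.
  by rewrite big_geq// subr0.
by rewrite -mulr_sumr ler_piMr// sum_inv_sqr_le1.
Qed.

Definition invsum m N : R := \sum_(1 <= n < N) 1 / (q n)%:R ^+ m.+1.
Definition invsum_lim m : R := limn (invsum m).

(** The partial sum up to [M] differs from the sum of the [G (q n)] by at most
    [B * sum_n (q n) ^ (- M - 1)], which is at most [B * 2 ^ (1 - M)] because
    [q n >= 2]. *)
Lemma cvg_sum_expansion B e G : 0 <= B -> has_expansion B e G ->
  (fun M => \sum_(1 <= m < M)
     e m * invsum_lim m) @ \oo
  --> limn (fun N => \sum_(1 <= n < N) G (q n)).
Proof.
move=> B0 eG; apply: (@cvg_geometric_dist _ _ (2 * B)) => [|M M0].
  by rewrite mulr_ge0.
pose S N := \sum_(1 <= n < N) G (q n)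
  - \sum_(1 <= m < M) e m * invsum m N.
have SN N : `|S N| <= 2 * B * 2^-1 ^+ M.
  have -> : S N = \sum_(1 <= n < N)
      (G (q n) - \sum_(1 <= m < M) e m / (q n)%:R ^+ m.+1).
    rewrite sumrB; congr (_ - _).
    rewrite /invsum; under eq_bigr do rewrite mulr_sumr.
    rewrite exchange_big_nat; apply: eq_bigr => n _; apply: eq_bigr => m _.
    by rewrite mul1r.
  apply: le_trans (ler_norm_sum _ _ _) _.
  apply: (@le_trans _ _ (\sum_(1 <= n < N)
      (B * 2^-1 ^+ M.-1) * ((q n)%:R ^+ 2)^-1)).
    rewrite big_nat [leRHS]big_nat; apply: ler_sum => n /andP[n0 _].
    have q0 := leq_ltn_trans (leq0n n) (qS n).
    apply: le_trans (eG _ _ q0 M0) _; rewrite -mulrA ler_wpM2l// mulrC.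
    by rewrite inv_expr_le_sqr.
  rewrite -mulr_sumr; apply: le_trans (ler_piMr _ (sum_inv_sqr_le1 N)) _.
    by rewrite mulr_ge0// exprn_ge0// invr_ge0.
  rewrite -[in leRHS](prednK M0) exprS le_eqVlt.
  by apply/orP; left; apply/eqP; field.
have Sl : S @ \oo --> limn (fun N => \sum_(1 <= n < N) G (q n)) -
  \sum_(1 <= m < M) e m * invsum_lim m.
  apply: cvgB; first exact: is_cvg_sum_expansion eG.
  have : (fun N => \sum_(1 <= m < M | (1 <= m < M)%N) e m * invsum m N)
      @ \oo -->
      \sum_(1 <= m < M | (1 <= m < M)%N) e m * invsum_lim m.
    apply: cvg_sumr => m /andP[m1 _].
    by apply: cvgMl_tmp; exact: is_cvg_sum_inv_expr.
  by rewrite -big_nat; under eq_fun do rewrite -big_nat.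
move/(@cvg_norm _ _ _ _ _): Sl => Sl.
rewrite -(cvg_lim _ Sl)//; apply: limr_le; first exact: cvgP Sl.
by apply: nearW => N.
Qed.
End series.

(** * The logarithm *)

Section tails.
Context (R : realType) (b d : nat).
Hypotheses (b_gt1 : (1 < b)%N) (d_lt_b : (d < b)%N).
Local Notation u := (moment R b d).
Local Notation tail := (tail R b d).

Let b_gt0 : 0 < b%:R :> R. Proof. by rewrite ltr0n ltnW. Qed.

(** The terms of order [1 / n] cancel because all [mu_k] have the same mass. *)
Lemma tail_diff_expansion j k :
  has_expansion b%:R (fun m => (-1) ^+ m.-1 * (u k m - u j m))
    (fun n => tail j n - tail k n).
Proof.
move=> n M n0 M0; have nR : 0 < n%:R :> R by rewrite ltr0n.
rewrite !(tail_expansion R b_gt1 d_lt_b _ n0 M0).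
set E := (X in `|X|).
have {E}-> : E = (-1) ^+ M *
    ((tail_rem R b d j n M - tail_rem R b d k n M) / n%:R ^+ M).
  rewrite /E; under [X in _ - X]eq_bigr do rewrite -mulrA mulrBl mulrBr.
  by rewrite sumrB mulrBl mulrBr; ring.
rewrite normrM normrX normrN1 expr1n mul1r normrM.
rewrite [X in _ * X]ger0_norm ?invr_ge0 ?exprn_ge0// exprS invfM mulrA.
rewrite ler_wpM2r ?invr_ge0 ?exprn_ge0//.
have /andP[h1 h2] := tail_rem_bounds R b_gt1 d_lt_b j M n0.
have /andP[h3 h4] := tail_rem_bounds R b_gt1 d_lt_b k M n0.
by rewrite ler_norml; apply/andP; split; lra.
Qed.

Lemma tail_expansion_dist k :
  has_expansion b%:R (fun m => (-1) ^+ m.-1 * u k m)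
    (fun n => b%:R / n%:R - tail k n).
Proof.
move=> n M n0 M0; have nR : 0 < n%:R :> R by rewrite ltr0n.
rewrite (tail_expansion R b_gt1 d_lt_b _ n0 M0).
set E := (X in `|X|).
have {E}-> : E = - ((-1) ^+ M * (tail_rem R b d k n M / n%:R ^+ M)).
  by rewrite /E; under [X in _ - X]eq_bigr do rewrite -mulrA; ring.
rewrite normrN normrM normrX normrN1 expr1n mul1r normrM.
rewrite [X in _ * X]ger0_norm ?invr_ge0 ?exprn_ge0// exprS invfM mulrA.
rewrite ler_wpM2r ?invr_ge0 ?exprn_ge0//.
have /andP[h1 h2] := tail_rem_bounds R b_gt1 d_lt_b k M n0.
by rewrite ger0_norm.
Qed.

Lemma lnS_bounds n : (0 < n)%N ->
  (n.+1%:R)^-1 <= ln (n.+1%:R : R) - ln n%:R <= n%:R^-1.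
Proof.
move=> n0; have nR : 0 < n%:R :> R by rewrite ltr0n.
have n1R : 0 < n.+1%:R :> R by rewrite ltr0n.
have n1E : n.+1%:R = n%:R + 1 :> R by rewrite natr1.
apply/andP; split.
  rewrite -opprB lerNr -ln_div ?posrE//.
  have -> : n%:R / n.+1%:R = 1 + - n.+1%:R^-1 :> R.
    by rewrite n1E; field; rewrite -n1E gt_eqF.
  by rewrite le_ln1Dx// ltrN2 invf_lt1// ltr1n.
rewrite -ln_div ?posrE//.
have -> : n.+1%:R / n%:R = 1 + n%:R^-1 :> R.
  by rewrite n1E; field; rewrite gt_eqF.
by rewrite le_ln1Dx// (@lt_trans _ _ 0)// ?ltrN10 ?invr_gt0.
Qed.

(** Summing over the integers with [J + 1] digits in base [b] is compatible
    with splitting by the next digit: the extensions of one block by a digit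
    form the next block. *)
Definition block k J : R := \sum_(b ^ J <= n < b ^ J.+1) tail k n.

(** The bounds on [tail] compare [tail k n] with [b * (ln (n + 1) - ln n)] up
    to an error [b * (1 / n - 1 / (n + 1))]; both sums over a block telescope,
    the first one to [b * ln b] and the second one to at most [b / b ^ J]. *)
Lemma cvg_block k : block k @ \oo --> b%:R * ln b%:R.
Proof.
apply: (@cvg_geometric_dist _ _ _ b%:R) => [|J J0]; first exact: ltW.
have bJ0 : (0 < b ^ J)%N by rewrite expn_gt0 ltnW.
have leJ : (b ^ J <= b ^ J.+1)%N by rewrite leq_exp2l.
have -> : b%:R * ln b%:R =
    \sum_(b ^ J <= n < b ^ J.+1) b%:R * (ln n.+1%:R - ln n%:R) :> R.
  rewrite -mulr_sumr (telescope_sumr (fun n => ln n%:R))//.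
  rewrite -ln_div ?posrE ?ltr0n ?expn_gt0 ?(ltnW b_gt1)//.
  by congr (_ * ln _); rewrite !natrX exprS mulfK// expf_neq0// gt_eqF.
rewrite /block -sumrB; apply: le_trans (ler_norm_sum _ _ _) _.
apply: (@le_trans _ _ (\sum_(b ^ J <= n < b ^ J.+1)
    b%:R * ((- n.+1%:R^-1) - (- n%:R^-1)))).
  rewrite big_nat [leRHS]big_nat; apply: ler_sum => n /andP[bn _].
  have n0 := leq_trans bJ0 bn.
  have /andP[h1 h2] := tail_bounds R b_gt1 d_lt_b k n0.
  have /andP[h3 h4] := lnS_bounds n0.
  rewrite -(ler_pM2l b_gt0) in h3; rewrite -(ler_pM2l b_gt0) in h4.
  rewrite ler_norml !mulrBr !mulrN in h3 h4 *; apply/andP; split;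
    move: h1 h2 h3 h4; move: (b%:R / _) (b%:R / _) (b%:R * ln _) (b%:R * ln _)
      (tail _ _) => x y l l' t; lra.
rewrite -mulr_sumr (telescope_sumr (fun n => - n%:R^-1))//.
rewrite ler_wpM2l ?(ltW b_gt0)//.
rewrite opprK; apply: (@le_trans _ _ ((b ^ J)%:R^-1 : R)).
  by rewrite gerDr oppr_le0 invr_ge0.
by rewrite natrX inv_expr_le2.
Qed.

Lemma sum_nat_mul (f : nat -> R) A B : (A <= B)%N ->
  \sum_(b * A <= m < b * B) f m =
  \sum_(A <= n < B) \sum_(0 <= a < b) f (b * n + a)%N.
Proof.
elim: B => [|B IH]; first by rewrite leqn0 => /eqP->; rewrite !big_geq// muln0.
rewrite leq_eqVlt => /predU1P[->|AB]; first by rewrite !big_geq.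
rewrite [RHS]big_nat_recr//= -IH// (@big_cat_nat _ _ _ (b * B))//=.
- congr (_ + _); rewrite -{1}[(b * B)%N]add0n big_addn mulnS addnK.
  by apply: eq_bigr => a _; rewrite addnC.
- by rewrite leq_mul2l -ltnS AB orbT.
- by rewrite leq_mul2l leqnSn orbT.
Qed.

(** With [tail k] also at the digit [d], the sum runs over all digits and can
    be assembled into a sum over an interval of integers; the last term
    corrects for this. *)
Lemma tail_rec_full k n : (0 < k)%N -> (0 < n)%N ->
  tail k n = \sum_(0 <= a < b) tail k (b * n + a)
    + (tail k.-1 (b * n + d) - tail k (b * n + d)).
Proof.
move=> k0 n0; rewrite (tail_rec R k b_gt1 d_lt_b n0) k0 mul1r eqn0Ngt k0.
rewrite mul0r add0r.
rewrite [in RHS](bigD1_seq d)/= ?mem_index_iota ?iota_uniq//.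
by ring.
Qed.

Lemma block_rec k J : (0 < k)%N ->
  block k J = block k J.+1 + \sum_(b ^ J <= n < b ^ J.+1)
    (tail k.-1 (b * n + d) - tail k (b * n + d)).
Proof.
move=> k0; rewrite /block [(b ^ J.+2)%N]expnS {2}[(b ^ J.+1)%N]expnS.
rewrite sum_nat_mul ?leq_exp2l// -big_split/= big_nat [RHS]big_nat.
apply: eq_bigr => n /andP[Jn _]; rewrite [LHS]tail_rec_full//.
by rewrite (leq_trans _ Jn)// expn_gt0 ltnW.
Qed.

Lemma block0E k J : (0 < k)%N ->
  block k 0 = block k J + \sum_(1 <= n < b ^ J)
    (tail k.-1 (b * n + d) - tail k (b * n + d)).
Proof.
move=> k0; elim: J => [|J ->]; first by rewrite expn0 big_geq// addr0.
rewrite block_rec// -addrA; congr (_ + _).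
rewrite [RHS](@big_cat_nat _ _ _ (b ^ J))/= ?expn_gt0 ?(ltnW b_gt1)//.
  by rewrite addrC.
by rewrite leq_exp2l.
Qed.

Lemma cvg_expn : (fun J => b ^ J)%N @ \oo --> \oo.
Proof.
apply/cvgnyPge => A; exists A => // J /= AJ.
exact: leq_trans AJ (ltnW (ltn_expl _ b_gt1)).
Qed.

Hypotheses (d_gt0 : (0 < d)%N).

(** The sum is the block with [J = 0], and the blocks with larger [J] converge
    to [b * ln b]. The differences between successive blocks make up the series
    on the right, of which [block0E] sees the partial sums up to the powers of
    [b]. *)
Lemma sum_tail_first_digit k : (0 < k)%N ->
  \sum_(1 <= a < b) tail k a = b%:R * ln b%:R +
    limn (fun N => \sum_(1 <= n < N)
      (tail k.-1 (b * n + d) - tail k (b * n + d))).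
Proof.
move=> k0.
have qS n : (n < b * n + d)%N by nia.
have cD := is_cvg_sum_expansion qS (ltW b_gt0) (tail_diff_expansion k.-1 k).
have -> : \sum_(1 <= a < b) tail k a = block k 0 by rewrite /block expn0 expn1.
have c1 : (fun J => block k J + \sum_(1 <= n < b ^ J)
    (tail k.-1 (b * n + d) - tail k (b * n + d))) @ \oo --> b%:R * ln b%:R +
    limn (fun N => \sum_(1 <= n < N)
      (tail k.-1 (b * n + d) - tail k (b * n + d))).
  apply: cvgD; first exact: cvg_block.
  exact: (cvg_comp _ _ cvg_expn cD).
move: c1; rewrite (_ : (fun J => _) = fun=> block k 0); last first.
  by apply/funext => J; rewrite -block0E.
by move=> /cvg_lim => <-//; rewrite lim_cst.
Qed.
End tails.

(** * The formula *)

(* The first conjuncts state that the infinite series of the formula converge,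
   so that none of the limits in the last one is a default value. *)
Theorem proposition11 (R : realType) (b d k : nat)
    (hb : (2 <= b)%N) (hd : (0 < d < b)%N) (hk : (1 <= k)%N) :
  let u : nat -> nat -> R := moment R b d in
  let p (m n : nat) : R := 1 / (b * n + d)%:R ^+ m.+1 in
  let c (m : nat) : R :=
    \sum_(1 <= n <oo) p m n
    + \sum_(0 <= a < b | a != d) 1 / (b * d + a)%:R ^+ m.+1 in
  let s (m : nat) : R := (-1) ^+ m.-1 * (u k m - u k.-1 m) * c m in
  let t (m : nat) : R :=
    (-1) ^+ m.-1 * ((u k.-1 m - u k.-2 m) / (b * d + d)%:R ^+ m.+1) in
  let v (m : nat) : R :=
    (-1) ^+ m.-1 * (u 0%N m / (b * d + d)%:R ^+ m.+1) in
  [/\ forall m : nat, (1 <= m)%N -> cvgn (fun N => \sum_(1 <= n < N) p m n),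
      cvgn (fun N => \sum_(1 <= m < N) s m),
      (1 < k)%N -> cvgn (fun N => \sum_(1 <= m < N) t m),
      k = 1%N -> cvgn (fun N => \sum_(1 <= m < N) v m)
    & irwin_sum R b d k =
        (b%:R * ln b%:R
         + \sum_(1 <= m <oo) s m
         + (1 < k)%N%:R * \sum_(1 <= m <oo) t m
         + (k == 1)%N%:R
             * (1 / (b * d + d)%:R + \sum_(1 <= m <oo) v m))%:E].
Proof.
move=> u p c s t v; have /andP[d0 db] := hd.
have bR : 0 <= b%:R :> R by [].
have qS n : (n < b * n + d)%N by nia.
have eG := tail_diff_expansion R hb db k.-1 k.
have bd2 a : (1 < b * d + a)%N by nia.
have cp m : (1 <= m)%N -> cvgn (fun N => \sum_(1 <= n < N) p m n).
  exact: is_cvg_sum_inv_expr.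
have cs : (fun N => \sum_(1 <= m < N) s m) @ \oo -->
    limn (fun N => \sum_(1 <= n < N)
      (tail R b d k.-1 (b * n + d) - tail R b d k (b * n + d))) +
    \sum_(0 <= a < b | a != d)
      (tail R b d k.-1 (b * d + a) - tail R b d k (b * d + a)).
  rewrite (_ : (fun N => _) = (fun M => \sum_(1 <= m < M)
      (-1) ^+ m.-1 * (u k m - u k.-1 m)
      * invsum_lim R (fun n => b * n + d)%N m)
    \+ (fun M => \sum_(0 <= a < b | a != d) \sum_(1 <= m < M)
      (-1) ^+ m.-1 * (u k m - u k.-1 m) / (b * d + a)%:R ^+ m.+1)).
    apply: cvgD; first exact: (cvg_sum_expansion qS bR eG).
    by apply: cvg_sumr => a _; exact: (cvg_expansion bR eG).
  apply/funext => M /=; rewrite exchange_big -big_split/=.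
  apply: eq_bigr => m _.
  rewrite /s /c mulrDr; congr (_ + _); rewrite mulr_sumr.
  by apply: eq_bigr => a _; rewrite mul1r.
have ct : (fun N => \sum_(1 <= m < N) t m) @ \oo -->
    tail R b d k.-2 (b * d + d) - tail R b d k.-1 (b * d + d).
  rewrite (_ : (fun N => _) = (fun M => \sum_(1 <= m < M)
      (-1) ^+ m.-1 * (u k.-1 m - u k.-2 m) / (b * d + d)%:R ^+ m.+1)).
    exact: (cvg_expansion bR (tail_diff_expansion R hb db k.-2 k.-1)).
  by apply/funext => M; apply: eq_bigr => m _; rewrite /t mulrA.
have cv : (fun N => \sum_(1 <= m < N) v m) @ \oo -->
    b%:R / (b * d + d)%:R - tail R b d 0 (b * d + d).
  rewrite (_ : (fun N => _) = (fun M => \sum_(1 <= m < M)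
      (-1) ^+ m.-1 * u 0%N m / (b * d + d)%:R ^+ m.+1)).
    exact: (cvg_expansion bR (tail_expansion_dist R hb db 0)).
  by apply/funext => M; apply: eq_bigr => m _; rewrite /v mulrA.
split=> //.
- exact: cvgP cs.
- by move=> _; exact: cvgP ct.
- by move=> _; exact: cvgP cv.
rewrite (cvg_lim _ cs)// (cvg_lim _ ct)// (cvg_lim _ cv)//.
rewrite irwin_sum_tail// sum_tail_first_digit//; congr EFin.
rewrite (tail_rec R k hb db d0) (tail_rec R k.-1 hb db d0).
rewrite sumrB; case: k hk {u c s t v eG cs ct cv} => // -[|k] _ /=.
(* For [k = 1], the empty string gives [1 / d] and [U_0(b * d + d)] is not
   paired with another integral, so its term of order [1 / n] survives. *)
- rewrite !mul0r !mul1r !add0r !addr0.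
  have dR : d%:R != 0 :> R by rewrite pnatr_eq0 -lt0n.
  have bdR : (b * d + d)%:R != 0 :> R.
    by rewrite pnatr_eq0 addn_eq0 negb_and -!lt0n d0 orbT.
  have -> : d%:R^-1 = (b * d + d)%:R^-1 + b%:R / (b * d + d)%:R :> R.
    rewrite natrD natrM in bdR *; field; rewrite dR /=.
    by rewrite -natrM -natrD pnatr_eq0; lia.
  by ring.
- by rewrite !mul0r !mul1r !add0r; ring.
Qed.
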